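(* (a) There exists $X$ which is a maximal orthogonal family in $l_2$ such that for all $n$ with $1\leq n\leq\omega$ there exists $Y\subseteq\mathbb{R}^\omega\setminus l_2$ with $|Y|=n$ and $X\cup Y$ a maximal orthogonal family in $\mathbb{R}^\omega$. Furthermore, every maximal orthogonal family in $\mathbb{R}^\omega$ containing $X$ is countable. (b) There exists a perfect set $P\subseteq\mathbb{R}^\omega$ (nonempty, closed, without isolated points) which is a maximal orthogonal family in $\mathbb{R}^\omega$ and such that $P\cap l_2$ is a maximal orthogonal family in $l_2$.
   Context: $\mathbb{R}^\omega$ is the set of all real sequences indexed by $\omega=\{0,1,2,\dots\}$, with the product topology. For $x,y\in\mathbb{R}^\omega$ the inner product is $(x,y)=\sum_{n\in\omega}x(n)y(n)$, which need not be finite or exist; $x$ and $y$ are orthogonal if the series $(x,y)$ converges (as the limit of its partial sums) and equals $0$. $l_2$ is the set of all $x\in\mathbb{R}^\omega$ with $\sum_{n\in\omega}|x(n)|^2<\infty$. A family $F\subseteq\mathbb{R}^\omega\setminus\{\mathbf{0}\}$ of pairwise orthogonal sequences is a maximal orthogonal family in $\mathbb{R}^\omega$ iff the only element of $\mathbb{R}^\omega$ orthogonal to every element of $F$ is $\mathbf{0}$, the constant $0$ sequence. A family $F\subseteq l_2\setminus\{\mathbf{0}\}$ of pairwise orthogonal sequences is a maximal orthogonal family in $l_2$ iff the only element of $l_2$ orthogonal to every element of $F$ is $\mathbf{0}$. In (a), $n$ ranges over the positive integers together with $\omega$, and $|Y|=\omega$ means that $Y$ is countably infinite. *)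

(* Defs.v *)
From HB Require Import structures.
From mathcomp Require Import all_boot all_order all_algebra.
From mathcomp Require Import all_classical all_reals all_analysis.

Set Implicit Arguments.
Unset Strict Implicit.
Unset Printing Implicit Defensive.

Import Order.TTheory GRing.Theory Num.Theory.
Import numFieldNormedType.Exports.

Local Open Scope classical_set_scope.
Local Open Scope ring_scope.

(* A bare [nat -> R] has no canonical topology; [{ptws nat -> R}] carries the
   product topology. *)
Definition Romega (R : realType) : Type := {ptws nat -> R}.

HB.instance Definition _ (R : realType) := Pointed.on (Romega R).
HB.instance Definition _ (R : realType) := Uniform.on (Romega R).

Section OrthogonalFamilies.
Variable R : realType.
Implicit Types (x y : Romega R) (E F : set (Romega R)).

Definition zero_seq : Romega R := fun=> 0.

(* The series need only converge conditionally. *)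
Definition seq_orthogonal x y : Prop :=
  series (fun n : nat => x n * y n) @ \oo --> (0 : R).

Definition l2 : set (Romega R) :=
  [set x : Romega R | (\sum_(0 <= n <oo) (`|x n| ^+ 2)%:E < +oo)%E].

(* Distinct elements only: no nonzero sequence is orthogonal to itself. *)
Definition pairwise_seq_orthogonal F : Prop :=
  forall x y, F x -> F y -> x <> y -> seq_orthogonal x y.

(* [F] is a maximal orthogonal family in the ambient set [E]; used with
   [E = setT] and [E = l2]. *)
Definition maximal_orthogonal_in E F : Prop :=
  [/\ F `<=` E `\ zero_seq,
      pairwise_seq_orthogonal F
    & forall x, E x -> (forall y, F y -> seq_orthogonal x y) -> x = zero_seq].

End OrthogonalFamilies.

Arguments l2 R : clear implicits.

(* Main.v *)
Require Import Defs.
From mathcomp Require Import all_boot all_order all_algebra.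
From mathcomp Require Import all_classical all_reals all_analysis.
From mathcomp Require Import zify ring lra.

Local Open Scope classical_set_scope.
Local Open Scope card_scope.

(** In both constructions the orthogonality of two members of the family is a
    matter of finite sums, so that conditional convergence never interferes.

    Part (a).  Split omega into infinitely many infinite blocks.  Inside each
    block, orthogonalize the differences of unit vectors: the vector
    [centered n] is 1 at the points of the block of [n] below [n], minus their
    number at [n], and 0 elsewhere.  These vectors are finitely supported, and
    a sequence is orthogonal to all of them iff it is constant on every block
    ([block_constantP]).  Such a sequence is in l_2 only if it is 0, since the
    blocks are infinite.  For the same reason, if x and y are constant on
    blocks, the terms of the series (x, y) recur forever, so that the series
    converges only if x and y have disjoint supports
    ([block_constant_mul_eq0]).  An orthogonal family extending X thus adds to it
    nonzero block-constant sequences with pairwise disjoint supports, hence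
    countably many.  Grouping the blocks into n classes, 1 <= n <= omega, and
    adding the indicator functions of the classes gives a maximal family.

    Part (b).  Grow vectors along the full binary tree, whose vertices s are
    numbered by [code s] = 1, 2, 3, ... as in a heap.  Coordinate 0 belongs to
    all vectors, and the coordinate [code s] is used by the two children of s
    alone.  If w is the squared norm of the vector [vec s] of the vertex s,
    and n is its number, the children extend [vec s] by the entries 1/n and
    - n w at coordinate n.  The product of these entries is - w, which makes
    the children orthogonal.  The limits along the infinite branches form the
    perfect set [branches]: any two are orthogonal by a finite computation,
    and the set is closed because membership restricts the first N
    coordinates to finitely many values, for each N.

    For completeness, let [dot x s] be the inner product of x with [vec s].
    The two entries have opposite signs, so some child satisfies
    |dot x s| <= |dot x child| ([dot_child_ge]).  Following such children from
    a vertex with [dot x s] != 0 yields a branch not orthogonal to x, and if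
    [dot x s] = 0 for all s then x = 0.  This settles maximality in R^omega.
    In l_2, only branches in l_2 may be used.  Those that turn left from some
    vertex on are in l_2, as their entries are eventually 0 or of the form
    1/n with n doubling.  If x, bounded by B, is orthogonal to them, then
    comparing [vec s] with the branch that goes left forever from s gives
    |dot x s| <= 2 B / code s ([leftmost_dot_le]).  Along a path on which
    |dot x s| does not decrease this forces [dot x s] = 0. *)

Section RealSequences.
Set Implicit Arguments.
Unset Strict Implicit.
Unset Printing Implicit Defensive.
Import Order.TTheory GRing.Theory Num.Theory.
Import numFieldNormedType.Exports.
Local Open Scope ring_scope.

Variable R : realType.
Implicit Types (x y z : Romega R).

(** * Convergence, l_2 and the product topology *)

Lemma seq_orthogonalC x y : seq_orthogonal x y -> seq_orthogonal y x.
Proof.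
rewrite /seq_orthogonal => xy.
by under [fun n => _]funext do rewrite mulrC.
Qed.

Lemma orthogonal_sum0 x y (N : nat) :
  (forall n, (N <= n)%N -> \sum_(0 <= i < n) x i * y i = 0) ->
  seq_orthogonal x y.
Proof.
move=> xy0; apply: (cvg_near_cst (0 : R)).
by exists N => // n /= Nn; apply: xy0.
Qed.

Lemma orthogonal_mul_cvg0 x y :
  seq_orthogonal x y -> (fun n => x n * y n) @ \oo --> (0 : R).
Proof. by move=> xy; apply: cvg_series_cvg_0; apply/cvg_ex; exists (0 : R). Qed.

(** The form in which limits are refuted throughout: a null sequence cannot
    stay away from 0 infinitely often. *)
Lemma cvg0_frequently (u : nat -> R) (a : R) :
  u @ \oo --> (0 : R) ->
  (forall N, exists2 n, (N <= n)%N & `|a| <= `|u n|) -> a = 0.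
Proof.
move=> u0 ua; apply/eqP; apply: contraT => a0.
have /cvgr0Pnorm_lt/(_ `|a|) := u0; rewrite normr_gt0 => /(_ a0) [N _ uN].
by have [n Nn] := ua N; rewrite leNgt uN.
Qed.

Lemma l2_cvg0 x : l2 R x -> x @ \oo --> (0 : R).
Proof.
rewrite /l2 /= => xoo.
have x2_cvg : cvgn (series (fun n => `|x n| ^+ 2)).
  by apply: nnseries_is_cvg => // n; rewrite exprn_ge0.
have /cvgr0Pnorm_lt x2_0 := cvg_series_cvg_0 x2_cvg.
apply/cvgr0Pnorm_lt => e e0.
have e2 : 0 < e ^+ 2 by rewrite exprn_gt0.
apply: filterS (x2_0 _ e2) => n /=.
by rewrite ger0_norm ?exprn_ge0// ltr_pXn2r// nnegrE ltW.
Qed.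

Lemma l2_bounded x : l2 R x -> exists B : R, forall n, `|x n| <= B.
Proof.
move=> /l2_cvg0 x0.
have /cvg_seq_bounded : cvgn (x : nat -> R) by apply/cvg_ex; exists (0 : R).
by move=> /pinfty_ex_gt0[B _ xB]; exists B => n; exact: xB.
Qed.

Lemma bounded_sum_l2 x (B : R) :
  (forall n, \sum_(0 <= i < n) x i ^+ 2 <= B) -> l2 R x.
Proof.
move=> xB; rewrite /l2 /=.
have ge0 n : true -> (0 <= (`|x n| ^+ 2)%:E)%E.
  by rewrite lee_fin exprn_ge0.
apply: (@le_lt_trans _ _ B%:E); last exact: ltry.
apply: lime_le; first exact: is_cvg_nneseries.
apply: nearW => n /=; rewrite sumEFin lee_fin.
by under eq_bigr do rewrite real_normK ?num_real//.
Qed.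

(** If no [N] worked, some sequence of points outside [U], the N-th of which agrees with
    [x] below [N], would converge to [x]. *)
Lemma cylinder_nbhs x (U : set (Romega R)) : nbhs x U ->
  exists N, forall y, (forall i, (i < N)%N -> y i = x i) -> U y.
Proof.
move=> xU; apply: contrapT => noN.
have {noN} /choice[f fP] : forall N, exists y,
    (forall i, (i < N)%N -> y i = x i) /\ ~ U y.
  move=> N; apply: contrapT => h; apply: noN; exists N => y yx.
  by apply: contrapT => nUy; apply: h; exists y.
have fx : f @ \oo --> x.
  have /= := @pointwise_cvgP _ _ (f @ \oo) x _.
  move=> [_]; apply=> t.
  apply: cvg_near_cst; exists t.+1 => // n /= tn.
  by have [->] := fP n.
have [N _ /(_ N (leqnn N))/=] := fx _ xU.
by have [] := fP N.
Qed.

Lemma closed_coordinate i (a : R) : closed [set y : Romega R | y i = a].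
Proof.
have proj_cont : continuous ((fun y => y i) : Romega R -> R).
  exact: (@proj_continuous nat (fun=> R) i).
by move/continuous_closedP : proj_cont => /(_ _ (@closed_eq _ a)).
Qed.

(** * Part (a): vectors centered on infinite blocks *)

(** The 2-adic valuation of [n.+1] is a convenient explicit map from nat to nat
    with infinite fibers. *)
Definition block (n : nat) : nat := logn 2 n.+1.

Lemma block_infinite b N : exists2 n, (N <= n)%N & block n = b.
Proof.
have pos : (0 < 2 ^ b * N.*2.+1)%N by rewrite muln_gt0 expn_gt0.
exists (2 ^ b * N.*2.+1).-1.
  by have : (0 < 2 ^ b)%N by [rewrite expn_gt0]; nia.
rewrite /block prednK// lognM ?expn_gt0// pfactorK// logn_coprime ?addn0//.
by rewrite coprime2n /= odd_double.
Qed.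

Definition block_constant z : Prop :=
  forall i j, block i = block j -> z i = z j.

(** The number of points of the block of [n] below [n], as a scalar. *)
Definition rank n : R := \sum_(0 <= i < n | block i == block n) 1.

Definition centered n : Romega R := fun i =>
  if block i != block n then 0
  else if (i < n)%N then 1 else if i == n then - rank n else 0.

Lemma rank_gt0 i n : (i < n)%N -> block i = block n -> 0 < rank n.
Proof.
move=> i_n bi; rewrite /rank big_mkord (bigD1 (Ordinal i_n)) /= ?bi//.
by rewrite ltr_pwDl// sumr_ge0.
Qed.

Lemma centered_gt n i : (n < i)%N -> centered n i = 0.
Proof.
move=> ni; rewrite /centered [(i < n)%N]ltnNge (ltnW ni) (gtn_eqF ni).
exact: if_same.
Qed.

Lemma sum_mul_centered z n N : (n < N)%N ->
  \sum_(0 <= i < N) z i * centered n i =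
  \sum_(0 <= i < n | block i == block n) z i - z n * rank n.
Proof.
move=> nN; rewrite (big_cat_nat (n := n)) ?(ltnW nN)//= [X in _ + X]big_ltn//.
rewrite [X in _ + (_ + X)]big_nat_cond [X in _ + (_ + X)]big1 ?addr0;
  last first.
  by move=> i /andP[/andP[ni _] _]; rewrite centered_gt ?mulr0.
rewrite {2}/centered !eqxx ltnn /= mulrN; congr (_ - _).
rewrite [RHS]big_mkcond /=; apply: eq_big_nat => i /andP[_ i_n].
by rewrite /centered i_n; case: eqP => /= _; rewrite ?mulr1 ?mulr0.
Qed.

(** The partial sums of the series are constant from [n.+1] on. *)
Lemma orthogonal_centeredP z n : seq_orthogonal z (centered n) <->
  \sum_(0 <= i < n | block i == block n) z i = z n * rank n.
Proof.
split=> [zn|zn].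
  apply/eqP; rewrite -subr_eq0; apply/eqP.
  apply: (cvg0_frequently zn) => N; exists (maxn N n.+1); first by lia.
  by rewrite /series /= sum_mul_centered//; lia.
apply: (@orthogonal_sum0 _ _ n.+1) => N nN.
by rewrite sum_mul_centered// zn subrr.
Qed.

Lemma block_constant_sum z n : block_constant z ->
  \sum_(0 <= i < n | block i == block n) z i = z n * rank n.
Proof.
move=> zc; rewrite /rank mulr_sumr; apply: eq_bigr => i /eqP bi.
by rewrite mulr1; apply: zc.
Qed.

(** If [z] is constant on the part of a block below [n], orthogonality to
    [centered n] says that [z n] is the average of these equal values. *)
Lemma block_constantP z : block_constant z <->
  forall n, rank n != 0 -> seq_orthogonal z (centered n).
Proof.
split=> [zc n _|zX].
  by apply/orthogonal_centeredP; exact: block_constant_sum.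
have lt_const n : forall i, (i < n)%N -> block i = block n -> z i = z n.
  elim/ltn_ind: n => n IH i i_n bi.
  have r0 := rank_gt0 i_n bi; have rn0 : rank n != 0 by rewrite gt_eqF.
  have /orthogonal_centeredP sumE := zX n rn0.
  apply: (mulIf rn0).
  rewrite -sumE /rank mulr_sumr big_nat_cond [RHS]big_nat_cond.
  apply: eq_bigr => j /andP[/andP[_ jn] /eqP bj]; rewrite mulr1.
  have [ij|ji|->//] := ltngtP i j; first by apply: IH; rewrite ?bi.
  by symmetry; apply: IH; rewrite ?bi.
move=> i j bij; have [ij|ji|->//] := ltngtP i j; first exact: lt_const.
by symmetry; apply: lt_const.
Qed.

(** A nonzero product would be repeated infinitely often as a term of the
    series, which therefore could not converge. *)
Lemma block_constant_mul_eq0 x y : block_constant x -> block_constant y ->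
  seq_orthogonal x y -> forall i, x i * y i = 0.
Proof.
move=> xc yc /orthogonal_mul_cvg0 xy i; apply: (cvg0_frequently xy) => N.
have [n Nn bn] := block_infinite (block i) N.
by exists n => //; rewrite (xc n i bn) (yc n i bn).
Qed.

Lemma block_constant_l2 x : block_constant x -> l2 R x -> x = @zero_seq R.
Proof.
move=> xc /l2_cvg0 x0; apply/funext => i; apply: (cvg0_frequently x0) => N.
have [n Nn bn] := block_infinite (block i) N.
by exists n => //; rewrite (xc n i bn).
Qed.

Lemma centered_l2 n : l2 R (centered n).
Proof.
apply: (@bounded_sum_l2 _ (\sum_(0 <= i < n.+1) centered n i ^+ 2)) => N.
have [Nn|nN] := leqP N n.+1.
  rewrite [leRHS](big_cat_nat (n := N)) //=.
  by rewrite lerDl sumr_ge0// => i _; rewrite sqr_ge0.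
rewrite (big_cat_nat (n := n.+1)) ?(ltnW nN)//= gerDl.
rewrite big_nat_cond big1// => i /andP[/andP[ni _] _].
by rewrite centered_gt ?expr0n.
Qed.

(** If [m < n], the support of [centered m] lies below [n], where [centered n]
    coincides with the indicator of a block; and indicators of blocks are
    orthogonal to [centered m]. *)
Lemma centered_orthogonal m n : m <> n ->
  seq_orthogonal (centered m) (centered n).
Proof.
wlog mn : m n / (m < n)%N => [H|_].
  by case: (ltngtP m n) => // [/H//|/H h /nesym /h /seq_orthogonalC].
apply/orthogonal_centeredP.
rewrite (centered_gt mn) mul0r.
pose z : Romega R := fun i => (block i == block n)%:R.
have zc : block_constant z by move=> i j ij; rewrite /z ij.
transitivity (\sum_(0 <= i < n) z i * centered m i).
  rewrite big_mkcond; apply: eq_bigr => i _; rewrite /z.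
  by case: eqP; rewrite ?mul1r ?mul0r.
by rewrite sum_mul_centered// block_constant_sum// subrr.
Qed.

(** The first point of each block has rank 0 and gives the zero vector, hence
    the restriction. *)
Definition centered_family : set (Romega R) :=
  [set centered n | n in [set n | rank n != 0]].

Lemma centered_family_neq0 : ~ centered_family (@zero_seq R).
Proof.
move=> [n /eqP rn0 /(congr1 (fun f : Romega R => f n))].
by rewrite /centered !eqxx ltnn /= => /eqP; rewrite oppr_eq0 => /eqP.
Qed.

Lemma centered_family_orthogonal : pairwise_seq_orthogonal centered_family.
Proof.
move=> _ _ [m _ <-] [n _ <-] mn; apply: centered_orthogonal => mnE.
by apply: mn; rewrite mnE.
Qed.

Lemma centered_family_orthP z : block_constant z <->
  forall x, centered_family x -> seq_orthogonal z x.
Proof.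
rewrite block_constantP; split=> [h _ [n rn <-]|h n rn]; first exact: h.
by apply: h; exists n.
Qed.

Lemma centered_family_maximal_l2 : maximal_orthogonal_in (l2 R) centered_family.
Proof.
split; [|exact: centered_family_orthogonal|].
  move=> x Xx; split; first by case: Xx => n _ <-; exact: centered_l2.
  by move=> x0; apply: centered_family_neq0; rewrite -x0.
by move=> x lx /centered_family_orthP xc; exact: block_constant_l2.
Qed.

(** The map [q] groups the blocks into classes; this is the indicator of the
    class [j], as a subset of omega. *)
Definition class_indicator (q : nat -> nat) j : Romega R :=
  fun i => (q (block i) == j)%:R.

(** The supports of the members of [Y] partition omega, so no support of a
    block-constant sequence is disjoint from all of them. *)
Lemma extend_centered_family (q : nat -> nat) : exists Y : set (Romega R),
  [/\ Y `<=` ~` l2 R, Y #= range q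
    & maximal_orthogonal_in setT (centered_family `|` Y)].
Proof.
pose ind := class_indicator q.
have indc j : block_constant (ind j).
  by move=> i k ik; rewrite /ind /class_indicator ik.
have ind1 k : exists i, ind (q k) i = 1 /\ block i = k.
  have [i _ bi] := block_infinite k 0.
  by exists i; rewrite /ind /class_indicator bi eqxx.
have ind_neq0 k : ind (q k) <> @zero_seq R.
  have [i [i1 _]] := ind1 k.
  move=> /(congr1 (fun f : Romega R => f i)); rewrite i1 => /eqP.
  by rewrite oner_eq0.
exists (ind @` range q); split.
- by move=> _ [_ [k _ <-] <-] /(block_constant_l2 (indc _)); exact: ind_neq0.
- apply: inj_card_eq => _ j /set_mem[k _ <-] _ kj.
  have [i [i1 bi]] := ind1 k; move: i1; rewrite kj /ind /class_indicator bi.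
  by case: eqP => // _ /eqP; rewrite eq_sym oner_eq0.
split.
- move=> y Yy; split=> // y0; case: Yy; rewrite y0.
    exact: centered_family_neq0.
  by move=> [_ [k _ <-]]; exact: ind_neq0.
- move=> x y [Xx|[j _ <-]] [Xy|[k _ <-]] xy.
  + exact: centered_family_orthogonal.
  + by apply: seq_orthogonalC; move: x Xx {xy}; apply/centered_family_orthP.
  + by move: y Xy {xy}; apply/centered_family_orthP.
  + apply: (@orthogonal_sum0 _ _ 0) => n _; rewrite big1// => i _.
    rewrite /ind /class_indicator.
    do 2 case: eqP => //= *; rewrite ?mulr0 ?mul0r//.
    by case: xy; congruence.
move=> x _ xXY.
have xc : block_constant x.
  by apply/centered_family_orthP => y Xy; apply: xXY; left.
apply/funext => i; pose y := ind (q (block i)).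
have xy : seq_orthogonal x y.
  by apply: xXY; right; exists (q (block i)) => //; exists (block i).
have := block_constant_mul_eq0 xc (indc _) xy i.
by rewrite /y /ind /class_indicator eqxx mulr1.
Qed.

(** The new members of [Z] are block-constant with disjoint supports: choosing a
    block in the support of each of them is injective. *)
Lemma maximal_extension_countable (Z : set (Romega R)) :
  maximal_orthogonal_in setT Z -> centered_family `<=` Z -> countable Z.
Proof.
move=> [Zn0 Zorth _] XZ.
pose W := Z `\` centered_family.
have Wc z : W z -> block_constant z.
  move=> [Zz nXz]; apply/centered_family_orthP => x Xx.
  by apply: Zorth => //; [exact: XZ|move=> zx; apply: nXz; rewrite zx].
have /choice[f fP] : forall z, exists i, W z -> z i <> 0.
  move=> z; apply: contrapT => h.
  have [Wz|nWz] := pselect (W z); last by apply: h; exists 0%N.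
  have [_] := Zn0 z Wz.1; apply; apply/funext => i; apply: contrapT => zi.
  by apply: h; exists i.
have -> : Z = \bigcup_(b in [set: bool]) if b then centered_family else W.
  rewrite -(setDUK XZ); apply/seteqP; split=> z.
    by case=> [Xz|Wz]; [exists true|exists false].
  by case=> -[] _; [left|right].
apply: bigcup_countable => // -[] _.
  exact/(sub_countable (card_image_le _ _))/countableP.
apply/countable_injP; exists (block \o f) => y z /set_mem Wy /set_mem Wz /= yz.
apply: contrapT => y_neq_z.
have yz_orth : seq_orthogonal y z.
  by apply: Zorth => //; [exact: Wy.1|exact: Wz.1].
have /eqP := block_constant_mul_eq0 (Wc _ Wy) (Wc _ Wz) yz_orth (f y).
rewrite (Wc z Wz _ _ yz) mulf_eq0 => /orP[] /eqP; exact: fP.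
Qed.

Lemma range_minn n : (0 < n)%N -> range (fun k => minn k n.-1) = `I_n.
Proof.
move=> n0; apply/seteqP; split=> [_ [k _ <-] /=|k /= kn]; first by lia.
by exists k => //; lia.
Qed.

(** * Part (b): a tree of orthogonal vectors *)

Implicit Types (s t u : seq bool) (b : bool).

(** A vertex of the binary tree is the list of the turns leading to it, last
    turn first, with [true] for right; its heap number has children [2n] and
    [2n+1]. *)
Fixpoint code s : nat := if s is b :: t then (b + (code t).*2)%N else 1%N.

Lemma code_gt0 s : (0 < code s)%N.
Proof. by elim: s => //= b s; case: b; lia. Qed.

Lemma code_inj : injective code.
Proof.
elim=> [|b s IH] [|b' t] //=; have := code_gt0.
- by move=> /(_ t); lia.
- by move=> /(_ s); lia.
move=> _ eq_st; have [bb' st] : b = b' /\ code s = code t.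
  by case: b b' eq_st => [] [] /=; lia.
by rewrite bb' (IH _ st).
Qed.

Lemma code_surj n : (0 < n)%N -> exists s, code s = n.
Proof.
elim/ltn_ind: n => -[//|[|n]] IH _; first by exists [::].
have [||s sE] := IH n.+2./2; [lia|lia|].
by exists (odd n.+2 :: s); rewrite /= sE -[RHS]odd_double_half.
Qed.

(** The entries of the two children have product [- w], the opposite of the
    squared norm of the common part of their vectors.  The choice of [n^-1] for
    the left child is what keeps the leftmost branches in l_2. *)
Definition entry (n : nat) (w : R) b : R := if b then - (n%:R * w) else n%:R^-1.

(** The squared norm of [vec s]; defined first because the entries of [vec]
    depend on it. *)
Fixpoint sqnorm s : R :=
  if s is b :: t then sqnorm t + entry (code t) (sqnorm t) b ^+ 2 else 1.

Definition label s b : R := entry (code s) (sqnorm s) b.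

Fixpoint vec s : Romega R :=
  if s is b :: t then fun i => vec t i + label t b *+ (i == code t)
  else fun i => (i == 0%N)%:R.

(** The inner product of [x] with the finitely supported [vec s]; see
    [sum_mul_vec]. *)
Fixpoint dot x s : R :=
  if s is b :: t then dot x t + x (code t) * label t b else x 0%N.

Lemma code_neq0 s : (code s)%:R != 0 :> R.
Proof. by rewrite pnatr_eq0 -lt0n code_gt0. Qed.

Lemma sqnorm_gt0 s : 0 < sqnorm s.
Proof. by elim: s => //= b s IH; rewrite ltr_pwDl// exprn_even_ge0. Qed.

Lemma label_mul s : label s true * label s false = - sqnorm s.
Proof. by rewrite /label /= mulNr mulrAC mulfV ?mul1r// code_neq0. Qed.

(** The support of [vec s] consists of 0 and the numbers of the proper
    ancestors of [s], which are at most half of [code s]. *)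
Lemma vec_eq0 s i : (0 < i)%N -> (code s < i.*2)%N -> vec s i = 0.
Proof.
move=> i0; elim: s => [|b s IH] /= si; first by rewrite gtn_eqF.
rewrite IH ?add0r; last by lia.
by rewrite gtn_eqF//; lia.
Qed.

Lemma vec_code s : vec s (code s) = 0.
Proof. by rewrite vec_eq0 ?code_gt0//; have := code_gt0 s; lia. Qed.

Lemma sum_mul_vec x s N : (code s < N.*2)%N ->
  \sum_(0 <= i < N) x i * vec s i = dot x s.
Proof.
elim: s => [|b s IH] /= sN.
  rewrite big_ltn; last by lia.
  rewrite eqxx mulr1 big_nat_cond big1 ?addr0// => i /andP[/andP[i0 _] _].
  by rewrite gtn_eqF// mulr0.
under eq_bigr do rewrite mulrDr.
rewrite big_split /= IH; last by lia.
congr (_ + _); rewrite (big_cat_nat (n := code s)) //=; last by lia.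
rewrite big_nat_cond big1 ?add0r => [|i /andP[/andP[_ si] _]]; last first.
  by rewrite ltn_eqF// mulr0.
rewrite big_ltn; last by lia.
rewrite eqxx mulr1n big_nat_cond big1 ?addr0// => i /andP[/andP[si _] _].
by rewrite gtn_eqF// mulr0.
Qed.

Lemma dot_vecC s t : dot (vec s) t = dot (vec t) s.
Proof.
rewrite -(@sum_mul_vec _ t (code s + code t)); last by have := code_gt0 s; lia.
rewrite -(@sum_mul_vec _ s (code s + code t)); last by have := code_gt0 t; lia.
by under eq_bigr do rewrite mulrC.
Qed.

(** The vertices with number from N to 2N - 1 form a cut of the tree: every
    infinite branch meets it exactly once.  Going from [N] to [N.+1] replaces
    the vertex number [N] by its two children. *)
Lemma frontier_step N s : (0 < N)%N -> (N.+1 <= code s < N.+1.*2)%N ->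
  (N < code s < N.*2)%N \/ exists b u, s = b :: u /\ code u = N.
Proof.
case: s => [|b u] /=; first by lia.
move=> N0 bN; case: (eqVneq (code u) N) => [uN|]; first by right; exists b, u.
by left; lia.
Qed.

(** Distinct vertices of a cut have orthogonal vectors.  In the induction on [N]
    the decisive case is that of two siblings, children of u: their common part
    contributes [sqnorm u] and their last entries contribute [- sqnorm u]. *)
Lemma dot_frontier N s t : (0 < N)%N ->
  (N <= code s < N.*2)%N -> (N <= code t < N.*2)%N ->
  dot (vec s) t = if s == t then sqnorm s else 0.
Proof.
case: N => // N _; elim: N => [|N IH] in s t *.
  have root u : (1 <= code u < 2)%N -> u = [::].
    by case: u => //= b u; have := code_gt0 u; lia.
  by move=> /root-> /root->.
have child b u t' : code u = N.+1 -> (N.+1 < code t' < N.+1.*2)%N ->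
    dot (vec t') (b :: u) = 0.
  move=> uN t'N /=; rewrite IH ?uN//; [|lia|lia].
  rewrite vec_eq0 ?uN//; last by lia.
  by rewrite mul0r addr0; case: eqP => // t'u; move: t'N; rewrite t'u uN; lia.
move=> /(frontier_step (ltn0Sn _)) sN /(frontier_step (ltn0Sn _)) tN.
case: sN => [sN|[b [u [-> uN]]]]; case: tN => [tN|[b' [v [-> vN]]]].
- by apply: IH; lia.
- rewrite child//; case: eqP => // sE.
  by move: sN; rewrite sE /= vN; lia.
- rewrite dot_vecC child//; case: eqP => // tE.
  by move: tN; rewrite -tE /= uN; lia.
have -> : v = u by apply: code_inj; rewrite uN.
have -> : dot (vec (b :: u)) (b' :: u) =
    dot (vec u) (b :: u) + vec (b :: u) (code u) * label u b'.
  by rewrite (dot_vecC u).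
rewrite eqseq_cons eqxx andbT /= IH ?uN; [|lia|lia].
rewrite -uN vec_code !eqxx mulr1n !add0r mul0r addr0 /label.
case: b b' => [] [] /=; rewrite ?eqxx ?expr2//.
  by rewrite label_mul subrr.
by rewrite mulrC label_mul subrr.
Qed.

(** Climbing from [s] to an ancestor only erases coordinates that are not below
    the number of that ancestor. *)
Lemma frontier_ancestor N s : (0 < N <= code s)%N ->
  exists t, (N <= code t < N.*2)%N /\ forall i, (i < N)%N -> vec t i = vec s i.
Proof.
elim: s => [|b s IH] sN; first by exists [::]; split=> //; move: sN => /=; lia.
have [sN2|sN2] := ltnP (code (b :: s)) N.*2.
  by exists (b :: s); split=> //; lia.
move: sN sN2 => /= sN sN2.
have [|t [tN ts]] := IH; first by lia.
exists t; split=> // i iN; rewrite ts// (_ : (i == code s) = false) ?addr0//.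
by apply/eqP; lia.
Qed.

(** The increments of [dot x s] at the two children have opposite signs. *)
Lemma dot_child_ge x s : exists b, `|dot x s| <= `|dot x (b :: s)|.
Proof.
have := code_neq0 s; have := code_gt0 s; rewrite -(ltr0n R) => c0 cn0.
have w0 := sqnorm_gt0 s.
have le_add (a d : R) : 0 <= a * d -> `|a| <= `|a + d|.
  move=> ad; rewrite -ler_sqr ?nnegrE// !real_normK ?num_real//.
  by have := sqr_ge0 d; nra.
have [dx|dx] := leP 0 (dot x s * x (code s)).
  exists false => /=; apply: le_add.
  by rewrite /label /= mulrA mulr_ge0// invr_ge0 ltW.
exists true => /=; apply: le_add.
by rewrite /label /= mulrN mulrN mulrA oppr_ge0 nmulr_rle0// mulr_ge0// ltW.
Qed.

(** The increment of [dot x] from a vertex to its left child recovers the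
    coordinate of [x] at that vertex. *)
Lemma dot_eq0 x : (forall s, dot x s = 0) -> x = @zero_seq R.
Proof.
move=> x0; apply/funext => -[|i]; first exact: (x0 [::]).
have [//|s <-] := @code_surj i.+1.
have /eqP := x0 (false :: s); rewrite /= x0 add0r /label /=.
by rewrite mulf_eq0 invr_eq0 (negPf (code_neq0 s)) orbF => /eqP.
Qed.

(** The descent from [s] that takes at each vertex the turn prescribed by the
    strategy [c]. *)
Fixpoint path (c : seq bool -> bool) s (k : nat) : seq bool :=
  if k is k'.+1 then c (path c s k') :: path c s k' else s.

Lemma code_path c s k : (code s + k <= code (path c s k))%N.
Proof.
elim: k => [|k IH] /=; first by rewrite addn0.
by have := code_gt0 (path c s k); lia.
Qed.

Lemma vec_path c s k d i : (i < code (path c s k))%N ->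
  vec (path c s (k + d)) i = vec (path c s k) i.
Proof.
elim: d => [|d IH] ik; first by rewrite addn0.
rewrite addnS /= IH// ltn_eqF ?addr0// (leq_trans ik)//.
elim: d {IH} => [|d IH]; rewrite ?addn0// addnS /=; lia.
Qed.

(** The limit of the vectors along [path c s].  The coordinate [i] no longer
    changes after [i] steps, because vertex numbers then exceed [i]. *)
Definition branch c s : Romega R := fun i => vec (path c s i) i.

Lemma branchE c s k i : (i < code (path c s k))%N ->
  branch c s i = vec (path c s k) i.
Proof.
move=> ik; rewrite /branch; have [ki|/ltnW ik'] := leqP k i.
  by rewrite -(subnKC ki) vec_path// subnKC.
rewrite -(subnKC ik') vec_path//.
by have := code_path c s i; have := code_gt0 s; lia.
Qed.

Lemma sum_mul_branch x c s k :
  \sum_(0 <= i < code (path c s k)) x i * branch c s i = dot x (path c s k).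
Proof.
rewrite -(@sum_mul_vec _ _ (code (path c s k))); last first.
  by have := code_gt0 (path c s k); lia.
by apply: eq_big_nat => i /andP[_ ik]; rewrite (branchE ik).
Qed.

(** The numbers [dot x (path c s k)] form a subsequence of the partial sums. *)
Lemma dot_path_cvg0 x c s : seq_orthogonal x (branch c s) ->
  (fun k => dot x (path c s k)) @ \oo --> (0 : R).
Proof.
move=> xb.
under [fun k => _]funext do rewrite -sum_mul_branch.
apply: (cvg_comp (fun k => code (path c s k)) _ _ xb).
apply/cvgnyPge => A; exists A => // k /= Ak.
by have := code_path c s k; lia.
Qed.

(** The limits along all infinite branches, described by their finite
    truncations instead of by the branches: closedness and orthogonality are
    then immediate. *)
Definition branches : set (Romega R) :=
  [set y : Romega R | forall N, (0 < N)%N -> exists s,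
    (N <= code s < N.*2)%N /\ forall i, (i < N)%N -> y i = vec s i].

Lemma branch_branches c s : branches (branch c s).
Proof.
move=> N N0; have [|t [tN tE]] := @frontier_ancestor N (path c s N).
  by have := code_path c s N; lia.
exists t; split=> // i iN; rewrite tE// (@branchE _ _ N)//.
by have := code_path c s N; lia.
Qed.

Lemma branches_neq0 : ~ branches (@zero_seq R).
Proof.
move=> /(_ 1%N isT)[[|b s] [/= s1 /(_ 0%N isT)]].
  by move/eqP; rewrite eq_sym oner_eq0.
by have := code_gt0 s; lia.
Qed.

(** Beyond a coordinate where they differ, the truncations of two members come
    from distinct vertices of the same cut, so all partial sums vanish. *)
Lemma branches_orthogonal : pairwise_seq_orthogonal branches.
Proof.
move=> y z Py Pz yz.
have [i yzi] : exists i, y i <> z i.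
  apply: contrapT => h; apply: yz; apply/funext => i.
  by apply: contrapT => yzi; apply: h; exists i.
apply: (@orthogonal_sum0 _ _ i.+1) => n i_n.
have n0 : (0 < n)%N by lia.
have [s [sn ys]] := Py n n0; have [t [tn zt]] := Pz n n0.
have -> : \sum_(0 <= j < n) y j * z j = dot (vec s) t.
  rewrite -(@sum_mul_vec _ _ n); last by case/andP: tn.
  by apply: eq_big_nat => j /andP[_ jn]; rewrite ys// zt.
rewrite (dot_frontier n0)//; case: eqP => // st.
by case: yzi; rewrite ys// zt// st.
Qed.

(** Each condition on truncations is a finite union of closed cylinders. *)
Lemma branches_closed : closed branches.
Proof.
have -> : branches = \bigcap_(N in [set N | (0 < N)%N])
    \bigcup_(s in [set s | (N <= code s < N.*2)%N])
    \bigcap_(i in `I_N) [set y | y i = vec s i].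
  apply/seteqP; split=> y Py N /= N0.
    by have [s [sN ys]] := Py N N0; exists s => // i iN; exact: ys.
  by have [s sN ys] := Py N N0; exists s; split=> // i iN; exact: ys.
apply: closed_bigI => N _; apply: closed_bigcup; last first.
  by move=> s _; apply: closed_bigI => i _; exact: closed_coordinate.
apply: (@sub_finite_set _ _ (code @^-1` `I_(N.*2))).
  by move=> s /= /andP[].
by apply: finite_preimage; [move=> ? ? _ _; exact: code_inj|exact: finite_II].
Qed.

(** A member that agrees with [vec s] on a long initial segment is approximated
    by branches through both children of [s]; these branches differ, so one of
    them is a different point. *)
Lemma branches_perfect : perfect_set branches.
Proof.
split; first exact: branches_closed.
apply/seteqP; split=> y.
  by move=> ylim; apply: branches_closed => U /ylim[z [_ Pz Uz]]; exists z.
move=> Py U /cylinder_nbhs[N UN].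
have [s [sN ys]] := Py N.+1 (ltn0Sn _).
pose z b := branch (fun=> false) (b :: s).
have zE b i : (i < code (b :: s))%N -> z b i = vec (b :: s) i.
  exact: (@branchE _ _ 0%N).
have Uz b : U (z b).
  apply: UN => i iN; rewrite zE /=; last by lia.
  by rewrite ltn_eqF ?addr0 ?ys//; lia.
have [b zy] : exists b, z b <> y.
  apply: contrapT => h.
  have zy b : z b = y by apply: contrapT => zy; apply: h; exists b.
  have := zy true; rewrite -(zy false).
  move=> /(congr1 (fun f : Romega R => f (code s))).
  have c0 := code_gt0 s.
  rewrite !zE /=; [|lia|lia].
  rewrite vec_code eqxx !add0r !mulr1n => lab.
  have {}lab : label s true = label s false := lab.
  have := label_mul s; rewrite lab -expr2 => h2.
  by have := sqr_ge0 (label s false); rewrite h2 oppr_ge0 leNgt sqnorm_gt0.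
by exists (z b); split=> //; [apply/eqP|exact: branch_branches].
Qed.

Lemma branches_complete x : (forall y, branches y -> seq_orthogonal x y) ->
  x = @zero_seq R.
Proof.
move=> xP; apply: dot_eq0 => s.
have [c cP] := choice (dot_child_ge x).
have x0 := dot_path_cvg0 (xP _ (@branch_branches c s)).
apply: (cvg0_frequently x0) => N; exists N => //.
by elim: N => //= N IH; apply: le_trans IH _; exact: cP.
Qed.

Let leftmost := branch (fun=> false).

(** The numbers of the vertices double at each left turn, so the squared norms
    stay bounded along the branch. *)
Lemma leftmost_l2 s : l2 R (leftmost s).
Proof.
set p := path (fun=> false) s.
have code_p k : (code s + k <= code (p k))%N by exact: code_path.
(* With C = code (p k), a step to the left adds C^-2 <= C^-1 to the squared
   norm and removes exactly C^-1 from the second term. *)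
have bound k : sqnorm (p k) + 2 / (code (p k))%:R <= sqnorm s + 2 / (code s)%:R.
  elim: k => [|k IH] //=; apply: le_trans IH; rewrite -/p.
  have := code_gt0 (p k); rewrite -(ler1n R) => c1.
  have := code_neq0 (p k); set C := (code _)%:R in c1 * => C0.
  rewrite add0n -muln2 natrM -/C -addrA lerD2l.
  have -> : (C * 2%:R)^-1 = C^-1 / 2 by field.
  have : C^-1 <= 1 by rewrite invf_le1// (lt_le_trans _ c1).
  have : 0 <= C^-1 by rewrite invr_ge0; lra.
  nra.
have dot_sqnorm k : dot (vec (p k)) (p k) = sqnorm (p k).
  rewrite (@dot_frontier (code (p k))) ?eqxx ?code_gt0//.
    by have := code_gt0 (p k); lia.
  by have := code_gt0 (p k); lia.
apply: (@bounded_sum_l2 _ (sqnorm s + 2 / (code s)%:R)) => n.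
apply: le_trans (bound n); apply: (@le_trans _ _ (sqnorm (p n))); last first.
  by rewrite lerDl divr_ge0.
rewrite -dot_sqnorm -(@sum_mul_vec _ _ (code (p n))); last first.
  by have := code_gt0 (p n); lia.
rewrite [leRHS](big_cat_nat (n := n)) //=; last by have := code_p n; lia.
rewrite -[leLHS]addr0 lerD//; last first.
  by apply: sumr_ge0 => i _; rewrite -expr2 sqr_ge0.
rewrite le_eqVlt; apply/orP; left; apply/eqP.
apply: eq_big_nat => i /andP[_ i_n].
rewrite -expr2 /leftmost (@branchE _ _ n)//.
by apply: leq_trans (code_p n); have := code_gt0 s; lia.
Qed.

(** Orthogonality makes [dot x] tend to 0 along the leftmost path from [s], on
    which its total variation is at most [B] times the sum of 1/C over
    C = code s, 2 code s, 4 code s, ... *)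
Lemma leftmost_dot_le x s (B : R) : (forall i, `|x i| <= B) ->
  seq_orthogonal x (leftmost s) -> `|dot x s| <= 2 * B / (code s)%:R.
Proof.
move=> xB /dot_path_cvg0.
set p := path (fun=> false) s => x0.
have B0 : 0 <= B by apply: le_trans (xB 0%N).
(* The same telescoping as for the squared norm: a step changes [dot x] by at
   most B / C and lowers the subtracted term 2 B / C by B / C. *)
have bound k :
    `|dot x s - dot x (p k)| <= 2 * B / (code s)%:R - 2 * B / (code (p k))%:R.
  elim: k => [|k IH] /=; first by rewrite !subrr normr0.
  rewrite -/p opprD addrA; apply: le_trans (ler_normB _ _) _.
  apply: le_trans (lerD IH (lexx _)) _.
  rewrite normrM normfV normr_nat add0n -muln2 natrM.
  have := code_neq0 (p k); set C := (code (p k))%:R => C0.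
  have -> : 2 * B / (C * 2%:R) = B / C by field.
  have : `|x (code (p k))| / C <= B / C by rewrite ler_wpM2r// invr_ge0 ler0n.
  lra.
have x0' : (fun k => `|dot x s - dot x (p k)|) @ \oo --> `|dot x s|.
  rewrite -[in X in _ --> X](subr0 (dot x s)).
  by apply: cvg_norm; apply: cvgB => //; exact: cvg_cst.
rewrite -(cvg_lim _ x0')//; apply: limr_le.
  by apply/cvg_ex; exists `|dot x s|.
apply: nearW => k; apply: le_trans (bound k) _.
by rewrite gerBl divr_ge0// mulr_ge0.
Qed.

(** A path on which |dot x| does not decrease contradicts the bound on |dot x|
    given by the leftmost branches, unless [dot x] vanishes. *)
Lemma branches_l2_complete x : l2 R x ->
  (forall y, (branches `&` l2 R) y -> seq_orthogonal x y) -> x = @zero_seq R.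
Proof.
move=> /l2_bounded[B xB] xP; apply: dot_eq0 => s.
have [c cP] := choice (dot_child_ge x).
have small t : `|dot x t| <= 2 * B / (code t)%:R.
  apply: leftmost_dot_le => //; apply: xP.
  by split; [exact: branch_branches|exact: leftmost_l2].
have B0 : 0 <= B by apply: le_trans (xB 0%N).
have large k : `|dot x s| <= `|dot x (path c s k)|.
  by elim: k => //= k IH; apply: le_trans IH _; exact: cP.
have bound k : `|dot x s| <= 2 * B * k.+1%:R^-1.
  apply: le_trans (large k) _; apply: le_trans (small _) _.
  rewrite ler_wpM2l ?mulr_ge0// lef_pV2 ?posrE ?ltr0n ?code_gt0// ler_nat.
  by have := code_path c s k; have := code_gt0 s; lia.
have /cvg0_frequently : (fun k => 2 * B * k.+1%:R^-1) @ \oo --> (0 : R).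
  by rewrite -[X in _ --> X](mulr0 (2 * B)); apply: cvgMr; exact: cvg_harmonic.
by apply=> N; exists N => //; rewrite [leRHS]ger0_norm// !mulr_ge0.
Qed.

Theorem exists_perfect_maximal_family : exists P : set (Romega R),
  [/\ P !=set0, perfect_set P, maximal_orthogonal_in setT P
    & maximal_orthogonal_in (l2 R) (P `&` l2 R)].
Proof.
exists branches; split.
- by exists (leftmost [::]); exact: branch_branches.
- exact: branches_perfect.
- split=> [y Py||x _]; [|exact: branches_orthogonal|exact: branches_complete].
  by split=> // y0; apply: branches_neq0; rewrite -y0.
- split=> [y [Py l2y]|y z [Py _] [Pz _]|x]; last exact: branches_l2_complete.
    by split=> // y0; apply: branches_neq0; rewrite -y0.
  exact: branches_orthogonal.
Qed.

End RealSequences.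

Theorem theorem7 (R : realType) :
  (exists X : set (Romega R),
     [/\ maximal_orthogonal_in (l2 R) X,
         forall n : nat, (1 <= n)%N ->
           exists Y : set (Romega R),
             [/\ Y `<=` ~` l2 R, Y #= `I_n
               & maximal_orthogonal_in setT (X `|` Y)],
         exists Y : set (Romega R),
             [/\ Y `<=` ~` l2 R, Y #= [set: nat]
               & maximal_orthogonal_in setT (X `|` Y)]
       & forall Z : set (Romega R),
           maximal_orthogonal_in setT Z -> X `<=` Z -> countable Z])
  /\
  (exists P : set (Romega R),
     [/\ P !=set0, perfect_set P, maximal_orthogonal_in setT P
       & maximal_orthogonal_in (l2 R) (P `&` l2 R)]).
Proof.
split; last exact: exists_perfect_maximal_family.
exists (@centered_family R); split.
- exact: centered_family_maximal_l2.
- move=> n n1.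
  (* Gathering all blocks from the n-th one on in the last class leaves
     exactly n classes. *)
  by rewrite -(range_minn n1); exact: extend_centered_family.
- by have := extend_centered_family R id; rewrite image_id.
- exact: maximal_extension_countable.
Qed.
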